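(* Let $\ell,r,m,n$ be integers with $2\le\ell\le r+1\le m\le n$, and let $Z=T_2^{m,r}\!\uparrow^{\ell-2}$. Define $C\in\mathcal S(n)$ and a morphism $v$ as follows. If $Z=P_\ell^\ell$ (the projective case in $\mathcal S_2\!\uparrow^{\ell-2}$), let $v$ be the inclusion $P_{\ell-1}^\ell\to P_\ell^\ell$ (its sink map in $\mathcal S_2\!\uparrow^{\ell-2}$) and put $C=P_n^n$. Otherwise $Z$ occurs as end term of an Auslander–Reiten sequence $0\to X\to Y\xrightarrow{v}Z\to0$ in $\mathcal S_2\!\uparrow^{\ell-2}$, and we put $C=\tau^{-1}_{\mathcal S(n)}X$. Then: (1) $\mathrm{Hom}_{\mathcal S}(C,Z)/\mathrm{Im}\,\mathrm{Hom}_{\mathcal S}(C,v)$ is a one-dimensional $k$-vector space; (2) for every $E\in\mathcal S(n)$, the pairing given by composition $$\frac{\mathrm{Hom}_{\mathcal S}(E,Z)}{\mathrm{Im}\,\mathrm{Hom}_{\mathcal S}(E,v)}\times\mathrm{Hom}_{\mathcal S}(C,E)\longrightarrow\frac{\mathrm{Hom}_{\mathcal S}(C,Z)}{\mathrm{Im}\,\mathrm{Hom}_{\mathcal S}(C,v)},\quad([g],f)\mapsto[gf],$$ is left non-degenerate, i.e. for every $g\in\mathrm{Hom}_{\mathcal S}(E,Z)$ not factoring through $v$ there is $f\in\mathrm{Hom}_{\mathcal S}(C,E)$ such that $gf$ does not factor through $v$.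
   Context: Let $R$ be a commutative principal ideal domain, $p$ a generator of a maximal ideal, $k=R/(p)$. A $p$-module is a finite-length $R$-module annihilated by some power of $p$; $P^m=R/(p^m)$. $\mathcal S$ is the category of embeddings $(A\subset B)$ of a submodule $A$ in a $p$-module $B$, morphisms $(A\subset B)\to(A'\subset B')$ being $R$-linear maps $f:B\to B'$ with $f(A)\subseteq A'$; it is an exact category (a sequence is exact if it is exact on submodules and on ambient modules). $\mathcal S_2$: full subcategory with $p^2A=0$; $\mathcal S(n)$: full subcategory with $p^nB=0$. Pickets: $P_\ell^m=(p^{m-\ell}P^m\subset P^m)$ for $0\le\ell\le m$. Bipickets: for $1\le r\le m-2$, $T_2^{m,r}$ is the embedding of the cyclic submodule generated by $(p^{m-2},p^{r-1})$ in $P^m\oplus P^r$; $T_2^{m,m-1}:=P_2^m$. Lifting: $(A\subset B)\!\uparrow=(p^{-1}A\subset B)$ with $p^{-1}A=\{b\in B:pb\in A\}$, identity on underlying maps of morphisms; $\uparrow^s$ is the $s$-fold iterate. $\mathcal S_2\!\uparrow^{\ell-2}$ is the full subcategory of $\mathcal S$ of all objects $X\!\uparrow^{\ell-2}$ with $X\in\mathcal S_2$. An Auslander–Reiten sequence in a full exact subcategory $\mathcal U$ is a non-split exact sequence $0\to X\to Y\xrightarrow{v}Z\to0$ in $\mathcal U$ with $X,Z$ indecomposable such that $v$ is right almost split in $\mathcal U$ (every non-split-epi morphism in $\mathcal U$ to $Z$ factors through $v$) and $X\to Y$ is left almost split. The category $\mathcal S(n)$ has Auslander–Reiten sequences; $\tau^{-1}_{\mathcal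 S(n)}X$ denotes the end term of the Auslander–Reiten sequence in $\mathcal S(n)$ starting at $X$. $\mathrm{Im}\,\mathrm{Hom}_{\mathcal S}(E,v)$ is the set of morphisms $E\to Z$ factoring through $v$. *)

(* Defs.v *)
From HB Require Import structures.
From mathcomp Require Import all_boot all_order all_algebra.
Set Implicit Arguments. Unset Strict Implicit. Unset Printing Implicit Defensive.
Import GRing.Theory.
Local Open Scope ring_scope.

Definition divides (R : idomainType) (a x : R) : Prop := exists c : R, x = c * a.

Definition is_ideal (R : idomainType) (I : R -> Prop) : Prop :=
  [/\ I 0, (forall x y, I x -> I y -> I (x + y)) & (forall a x, I x -> I (a * x))].

Definition is_PID (R : idomainType) : Prop :=
  forall I : R -> Prop, is_ideal I -> exists a : R, forall x, I x <-> divides a x.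

Definition generates_maximal_ideal (R : idomainType) (p : R) : Prop :=
  ~ divides p 1 /\
  forall J : R -> Prop, is_ideal J -> (forall x, divides p x -> J x) ->
    (forall x, J x -> divides p x) \/ (forall x, J x).

Definition submod (R : idomainType) (B : lmodType R) (A : B -> Prop) : Prop :=
  [/\ A 0, (forall x y, A x -> A y -> A (x + y)) & (forall a x, A x -> A (a *: x))].

Definition finite_length (R : idomainType) (B : lmodType R) : Prop :=
  exists (k : nat) (c : nat -> B -> Prop),
    [/\ forall i, submod (c i),
        forall b, c 0%N b <-> b = 0,
        forall b, c k b &
        forall i, (i < k)%N ->
          [/\ forall b, c i b -> c i.+1 b,
              exists b, c i.+1 b /\ ~ c i b &
              forall N : B -> Prop, submod N -> (forall b, c i b -> N b) ->
                (forall b, N b -> c i.+1 b) ->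
                (forall b, N b <-> c i b) \/ (forall b, N b <-> c i.+1 b)]].

Definition p_module (R : idomainType) (p : R) (B : lmodType R) : Prop :=
  finite_length B /\ exists N : nat, forall b : B, p ^+ N *: b = 0.

(* an object (A ⊂ B): an ambient module B together with a subset A
   (required to be a submodule by [in_S]) *)
Record sobj (R : idomainType) := SObj { amb : lmodType R ; sbm : amb -> Prop }.
Arguments SObj {R} amb sbm.
Arguments sbm {R} s _.
Arguments amb {R} s.

Definition in_S (R : idomainType) (p : R) (X : sobj R) : Prop :=
  p_module p (amb X) /\ submod (sbm X).

Definition in_Sn (R : idomainType) (p : R) (n : nat) (X : sobj R) : Prop :=
  in_S p X /\ forall b : amb X, p ^+ n *: b = 0.

Definition is_hom (R : idomainType) (X Y : sobj R) (f : amb X -> amb Y) : Prop :=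
  (forall (a : R) (x y : amb X), f (a *: x + y) = a *: f x + f y) /\
  (forall x, sbm X x -> sbm Y (f x)).
Arguments is_hom {R} X Y f.

Definition lift (R : idomainType) (p : R) (B : lmodType R) (A : B -> Prop) : B -> Prop :=
  fun b => A (p *: b).

Definition lift_obj (R : idomainType) (p : R) (s : nat) (X : sobj R) : sobj R :=
  SObj (amb X) (iter s (@lift R p (amb X)) (sbm X)).

Definition in_S2lift (R : idomainType) (p : R) (s : nat) (X : sobj R) : Prop :=
  in_S p X /\
  exists A0 : amb X -> Prop,
    [/\ submod A0, (forall a, A0 a -> p ^+ 2 *: a = 0) &
        forall b, sbm X b <-> iter s (@lift R p (amb X)) A0 b].

Definition indecomposable (R : idomainType) (X : sobj R) : Prop :=
  (exists b : amb X, b <> 0) /\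
  forall e : amb X -> amb X, is_hom X X e -> (forall x, e (e x) = e x) ->
    (forall x, e x = 0) \/ (forall x, e x = x).

Definition split_epi (R : idomainType) (Y Z : sobj R) (v : amb Y -> amb Z) : Prop :=
  exists s : amb Z -> amb Y, is_hom Z Y s /\ forall z, v (s z) = z.

Definition split_mono (R : idomainType) (X Y : sobj R) (u : amb X -> amb Y) : Prop :=
  exists t : amb Y -> amb X, is_hom Y X t /\ forall x, t (u x) = x.

Definition factors_through (R : idomainType) (E Y Z : sobj R)
    (g : amb E -> amb Z) (v : amb Y -> amb Z) : Prop :=
  exists h : amb E -> amb Y, is_hom E Y h /\ forall x, g x = v (h x).

Definition right_almost_split (R : idomainType) (U : sobj R -> Prop)
    (Y Z : sobj R) (v : amb Y -> amb Z) : Prop :=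
  [/\ U Y, U Z, is_hom Y Z v, ~ split_epi v &
      forall (W : sobj R) (h : amb W -> amb Z), U W -> is_hom W Z h -> ~ split_epi h ->
        factors_through h v].

Definition left_almost_split (R : idomainType) (U : sobj R -> Prop)
    (X Y : sobj R) (u : amb X -> amb Y) : Prop :=
  [/\ U X, U Y, is_hom X Y u, ~ split_mono u &
      forall (W : sobj R) (h : amb X -> amb W), U W -> is_hom X W h -> ~ split_mono h ->
        exists h' : amb Y -> amb W, is_hom Y W h' /\ forall x, h x = h' (u x)].

Definition exact_seq (R : idomainType) (X Y Z : sobj R)
    (u : amb X -> amb Y) (v : amb Y -> amb Z) : Prop :=
  [/\ is_hom X Y u /\ is_hom Y Z v,
      (forall x, u x = 0 -> x = 0),
      (forall y, v y = 0 <-> exists x, y = u x) /\ (forall z, exists y, z = v y),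
      (forall y, sbm Y y -> v y = 0 -> exists x, sbm X x /\ y = u x) &
      (forall z, sbm Z z -> exists y, sbm Y y /\ z = v y)].

Definition AR_sequence (R : idomainType) (U : sobj R -> Prop) (X Y Z : sobj R)
    (u : amb X -> amb Y) (v : amb Y -> amb Z) : Prop :=
  [/\ U X /\ U Y /\ U Z, exact_seq u v, ~ split_epi v,
      indecomposable X /\ indecomposable Z &
      right_almost_split U v /\ left_almost_split U u].

(* e generates B and B ≅ P^m = R/(p^m) via a ↦ a e *)
Definition cyclic_pres (R : idomainType) (p : R) (m : nat) (B : lmodType R) (e : B) : Prop :=
  (forall a : R, a *: e = 0 <-> divides (p ^+ m) a) /\ (forall b : B, exists a, b = a *: e).

(* B ≅ P^m ⊕ P^r via (a1, a2) ↦ a1 e1 + a2 e2 *)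
Definition bicyclic_pres (R : idomainType) (p : R) (m r : nat) (B : lmodType R)
    (e1 e2 : B) : Prop :=
  (forall a1 a2 : R, a1 *: e1 + a2 *: e2 = 0 <->
      divides (p ^+ m) a1 /\ divides (p ^+ r) a2) /\
  (forall b : B, exists a1 a2, b = a1 *: e1 + a2 *: e2).

Definition is_picket (R : idomainType) (p : R) (l m : nat) (T : sobj R) : Prop :=
  exists e : amb T, cyclic_pres p m e /\
    forall b, sbm T b <-> exists a : R, b = a *: (p ^+ (m - l) *: e).

(* T is (a copy of) the bipicket T_2^{m,r}:
   for 1 <= r <= m-2 the cyclic submodule generated by (p^{m-2}, p^{r-1})
   in P^m ⊕ P^r, and T_2^{m,m-1} := P_2^m *)
Definition is_T2 (R : idomainType) (p : R) (m r : nat) (T : sobj R) : Prop :=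
  if (r.+1 == m) then is_picket p 2 m T
  else exists e1 e2 : amb T, bicyclic_pres p m r e1 e2 /\
    forall b, sbm T b <-> exists a : R, b = a *: (p ^+ (m - 2) *: e1 + p ^+ (r - 1) *: e2).

(* Hom(C,Z)/Im Hom(C,v) is a one-dimensional k-vector space, k = R/(p):
   it is generated by the class of h, that class is nonzero and killed by p *)
Definition one_dim_quotient (R : idomainType) (p : R) (C Y Z : sobj R)
    (v : amb Y -> amb Z) : Prop :=
  exists h : amb C -> amb Z,
    [/\ is_hom C Z h, ~ factors_through h v,
        factors_through (fun x => p *: h x) v &
        forall g : amb C -> amb Z, is_hom C Z g ->
          exists a : R, factors_through (fun x => g x - a *: h x) v].

Definition left_nondegenerate (R : idomainType) (p : R) (n : nat) (C Y Z : sobj R)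
    (v : amb Y -> amb Z) : Prop :=
  forall (E : sobj R) (g : amb E -> amb Z), in_Sn p n E -> is_hom E Z g ->
    ~ factors_through g v ->
    exists f : amb C -> amb E, is_hom C E f /\ ~ factors_through (fun x => g (f x)) v.

(* Main.v *)
Require Import Defs.
From Stdlib Require Import Classical.
From HB Require Import structures.
From mathcomp Require Import all_boot all_order all_algebra.
From mathcomp Require Import zify ring.
Set Implicit Arguments. Unset Strict Implicit. Unset Printing Implicit Defensive.
Import GRing.Theory.
Local Open Scope ring_scope.

(* Write xi for the sequence X -> Y -> Z. A morphism g : E -> Z factors through
   v iff the pullback of xi along g splits, and a morphism of exact sequences
   (a, b, c) has c factoring through the target's epi iff a extends along the
   source's mono ([factors_iff_extends]).

   Y lies in S(n), since some non-split epi onto Z with domain killed by p^m is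
   surjective and factors through v. Hence the pullback X -> W -> E of xi along
   a g not factoring through v is a non-split sequence in S(n), so X -> W
   factors through u'; on cokernels this gives f : C -> E, and g f pulls xi
   back to the Auslander-Reiten sequence X -> Y' -> C, which does not split.

   For one-dimensionality, u = h' u' induces h : C -> Z. If g : C -> Z does not
   factor through v, then W -> C factors through v', which induces an
   endomorphism of X. Endomorphisms of X have the same residues as the induced
   endomorphisms of Z, and those are residues of elements of R because Z is a
   picket or bipicket; so h is congruent to a g with a a unit modulo p. *)

(** * Morphisms of embeddings, kernels and cokernels in exact sequences *)

Section Homs.
Variable R : idomainType.
Implicit Types X Y Z : sobj R.

Lemma hom0 X Y (f : amb X -> amb Y) : is_hom X Y f -> f 0 = 0.
Proof.
by move=> [lf _]; have := lf (-1) 0 0; rewrite scaler0 addr0 scaleN1r addNr.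
Qed.

Lemma homD X Y (f : amb X -> amb Y) : is_hom X Y f -> {morph f : x y / x + y}.
Proof. by move=> [lf _] x y; have := lf 1 x y; rewrite !scale1r. Qed.

Lemma homZ X Y (f : amb X -> amb Y) :
  is_hom X Y f -> forall a, {morph f : x / a *: x}.
Proof. by move=> hf a x; have := hf.1 a x 0; rewrite (hom0 hf) !addr0. Qed.

Lemma homB X Y (f : amb X -> amb Y) : is_hom X Y f -> {morph f : x y / x - y}.
Proof. by move=> hf x y; rewrite -!scaleN1r homD // homZ. Qed.

Lemma is_hom_id X : is_hom X X id.
Proof. by []. Qed.

Lemma is_hom_comp X Y Z (f : amb X -> amb Y) (g : amb Y -> amb Z) :
  is_hom X Y f -> is_hom Y Z g -> is_hom X Z (fun x => g (f x)).
Proof.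
by move=> [lf sf] [lg sg]; split=> [a x y|x /sf/sg]; rewrite ?lf ?lg.
Qed.

Lemma is_hom_scale X Y (f : amb X -> amb Y) a :
  submod (sbm Y) -> is_hom X Y f -> is_hom X Y (fun x => a *: f x).
Proof.
move=> [_ _ sY] [lf sf]; split=> [b x y|x /sf]; last exact: sY.
by rewrite lf scalerDr !scalerA mulrC.
Qed.

Lemma is_hom_sub X Y (f g : amb X -> amb Y) :
  submod (sbm Y) -> is_hom X Y f -> is_hom X Y g -> is_hom X Y (fun x => f x - g x).
Proof.
move=> [_ aY sY] [lf sf] [lg sg]; split=> [b x y|x Ax].
  by rewrite lf lg scalerBr opprD addrACA.
by rewrite -scaleN1r; apply: aY (sf _ Ax) (sY _ _ (sg _ Ax)).
Qed.

Lemma is_hom_zero X Y : submod (sbm Y) -> is_hom X Y (fun=> 0).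
Proof. by move=> [Y0 _ _]; split=> // a x y; rewrite scaler0 addr0. Qed.

Definition extends_along X Y W (h : amb X -> amb W) (u : amb X -> amb Y) : Prop :=
  exists h' : amb Y -> amb W, is_hom Y W h' /\ forall x, h x = h' (u x).

Section ExactSequence.
Variables (X Y Z : sobj R) (u : amb X -> amb Y) (v : amb Y -> amb Z).
Hypothesis exuv : exact_seq u v.

Lemma exact_homl : is_hom X Y u. Proof. by case: exuv => -[]. Qed.
Lemma exact_homr : is_hom Y Z v. Proof. by case: exuv => -[]. Qed.

Lemma exact_inj : injective u.
Proof.
case: exuv => -[hu _] u0 _ _ _ x y uxy; apply/eqP; rewrite -subr_eq0; apply/eqP.
by apply: u0; rewrite homB // uxy subrr.
Qed.

Lemma exact_comp0 x : v (u x) = 0.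
Proof. by case: exuv => _ _ [ker _] _ _; apply/ker; exists x. Qed.

Lemma exact_surj z : exists y, z = v y.
Proof. by case: exuv => _ _ []. Qed.

Lemma exact_lift W (w : amb W -> amb Y) : is_hom W Y w ->
  (forall x, v (w x) = 0) -> factors_through w u.
Proof.
move=> hw vw0; have hu := exact_homl.
(* Boolean equality lets [xchoose] turn pointwise preimages under [u] into a function. *)
have ex x : exists y, w x == u y.
  by case: exuv => _ _ [ker _] _ _; case/ker: (vw0 x) => y ->; exists y.
pose k x := xchoose (ex x).
have kE x : w x = u (k x) by apply/eqP; apply: (xchooseP (ex x)).
exists k; split=> //; split=> [a x y|x Ax].
  by apply: exact_inj; rewrite -kE hu.1 -!kE hw.1.
case: exuv => _ _ _ sub _; case: (sub _ (hw.2 _ Ax) (vw0 x)) => y [Ay wy].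
by rewrite (exact_inj (etrans (esym (kE x)) wy)).
Qed.

(** [w] is constant on the fibres of [v], so it descends. On the submodule of [Z] it is computed at
    a preimage in the submodule of [Y], which exactness on submodules supplies. *)
Lemma exact_desc W (w : amb Y -> amb W) : is_hom Y W w ->
  (forall x, w (u x) = 0) -> extends_along w v.
Proof.
move=> hw wu0; have hv := exact_homr.
have ex z : exists y, z == v y by case: (exact_surj z) => y ->; exists y.
pose s z := xchoose (ex z).
have sE z : z = v (s z) by apply/eqP; apply: (xchooseP (ex z)).
have wv y1 y2 : v y1 = v y2 -> w y1 = w y2.
  move=> vy; apply/eqP; rewrite -subr_eq0 -homB //.
  have: v (y1 - y2) = 0 by rewrite homB // vy subrr.
  by case: exuv => _ _ [ker _] _ _ /ker[x ->]; rewrite wu0.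
exists (fun z => w (s z)); split=> [|y]; last by apply: wv; rewrite -sE.
split=> [a x y|z Az].
  by rewrite -hw.1; apply: wv; rewrite hv.1 -!sE.
case: exuv => _ _ _ _ sub; case: (sub _ Az) => y [Ay zy].
by rewrite (wv (s z) y) -?sE //; apply: hw.2.
Qed.

Lemma split_mono_epi : submod (sbm Y) -> split_mono u -> split_epi v.
Proof.
move=> sY [r [hr ru]]; have hu := exact_homl.
have [|s [hs sv]] := @exact_desc _ (fun y => y - u (r y))
  (is_hom_sub sY (@is_hom_id Y) (is_hom_comp hr hu)).
  by move=> x; rewrite ru subrr.
exists s; split=> // z; have [y ->] := exact_surj z.
by rewrite -sv homB ?exact_comp0 ?subr0 //; apply: exact_homr.
Qed.

End ExactSequence.

(** A homotopy argument. If [c = v2 s], then [b - s v1] lands in the kernel of [v2] and its lift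
    along [u2] extends [a]. If [a = r u1], then [b - u2 r] kills the image of [u1] and descends to a
    factorization of [c]. *)
Lemma factors_iff_extends X1 Y1 Z1 X2 Y2 Z2
    (u1 : amb X1 -> amb Y1) (v1 : amb Y1 -> amb Z1)
    (u2 : amb X2 -> amb Y2) (v2 : amb Y2 -> amb Z2)
    (a : amb X1 -> amb X2) (b : amb Y1 -> amb Y2) (c : amb Z1 -> amb Z2) :
  exact_seq u1 v1 -> exact_seq u2 v2 -> submod (sbm Y2) -> is_hom Y1 Y2 b ->
  (forall x, u2 (a x) = b (u1 x)) -> (forall y, v2 (b y) = c (v1 y)) ->
  factors_through c v2 <-> extends_along a u1.
Proof.
move=> ex1 ex2 sY2 hb ba cb.
have [[hu2 hv1] hv2] := (exact_homl ex2, exact_homr ex1, exact_homr ex2).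
split=> [[s [hs cs]]|[r [hr ar]]].
- have [|r [hr br]] := @exact_lift _ _ _ _ _ ex2 Y1 (fun y => b y - s (v1 y))
    (is_hom_sub sY2 hb (is_hom_comp hv1 hs)).
    by move=> y; rewrite homB // cb cs subrr.
  exists r; split=> // x; apply: (exact_inj ex2).
  by rewrite -br ba (exact_comp0 ex1) (hom0 hs) subr0.
- have [|s [hs bs]] := @exact_desc _ _ _ _ _ ex1 _ (fun y => b y - u2 (r y))
    (is_hom_sub sY2 hb (is_hom_comp hr hu2)).
    by move=> x; rewrite -ar ba subrr.
  exists s; split=> // z; have [y ->] := exact_surj ex1 z.
  by rewrite -bs homB // cb (exact_comp0 ex2) subr0.
Qed.

End Homs.

(** * Extensions of modules of finite length *)

Section FiniteLength.
Variable R : idomainType.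

(** A composition series of [A], pushed forward along [i], is continued by the preimages under [q]
    of a series of [C]. *)
Lemma finite_length_ext (A B C : lmodType R) (i : A -> B) (q : B -> C) :
  linear i -> linear q -> injective i ->
  (forall b, q b = 0 <-> exists a, b = i a) -> (forall c, exists b, c = q b) ->
  finite_length A -> finite_length C -> finite_length B.
Proof.
move=> li lq inji ker surj [k [c [cS c0 cT cK]]] [k' [d [dS d0 dT dK]]].
have i0 : i 0 = 0 by have := li (-1) 0 0; rewrite scaler0 addr0 scaleN1r addNr.
have q0 : q 0 = 0 by have := lq (-1) 0 0; rewrite scaler0 addr0 scaleN1r addNr.
have iD x y : i (x + y) = i x + i y by have := li 1 x y; rewrite !scale1r.
have qD x y : q (x + y) = q x + q y by have := lq 1 x y; rewrite !scale1r.
have iZ a x : i (a *: x) = a *: i x by have := li a x 0; rewrite i0 !addr0.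
have qZ a x : q (a *: x) = a *: q x by have := lq a x 0; rewrite q0 !addr0.
pose e j b := if (j < k)%N then exists a, c j a /\ b = i a else d (j - k)%N (q b).
(* At index [k] both descriptions agree, because the image of [i] is the kernel of [q]. *)
have eL j b : (j <= k)%N -> e j b <-> exists a, c j a /\ b = i a.
  rewrite leq_eqVlt /e; case: ltngtP => // -> _; rewrite subnn d0 ker.
  by split=> [[a ->]|[a [_ ->]]]; exists a.
have eR j b : e (k + j)%N b <-> d j (q b).
  by rewrite /e ltnNge leq_addr /= addKn.
exists (k + k')%N, e; split.
- move=> j; have [ltjk|] := ltnP j k.
    have [s0 sD sZ] := cS j; split.
    + by apply/(eL _ _ (ltnW ltjk)); exists 0; rewrite i0.
    + move=> x y /(eL _ _ (ltnW ltjk))[a [ca ->]] /(eL _ _ (ltnW ltjk))[b [cb ->]].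
      by apply/(eL _ _ (ltnW ltjk)); exists (a + b); rewrite iD; split; auto.
    + move=> t x /(eL _ _ (ltnW ltjk))[a [ca ->]].
      by apply/(eL _ _ (ltnW ltjk)); exists (t *: a); rewrite iZ; split; auto.
  move/subnKC => <-; have [s0 sD sZ] := dS (j - k)%N; split.
  + by apply/eR; rewrite q0.
  + by move=> x y /eR dx /eR dy; apply/eR; rewrite qD; auto.
  + by move=> t x /eR dx; apply/eR; rewrite qZ; auto.
- move=> b; rewrite (eL _ _ (leq0n k)); split=> [[a [/c0 -> ->]] //|->].
  by exists 0; split=> //; apply/c0.
- by move=> b; apply/eR.
move=> j; have [ltjk _|lekj] := ltnP j k.
  have [sub [a [ca cNa]] simple] := cK _ ltjk.
  have [L1 L2] := (fun b => eL j b (ltnW ltjk), fun b => eL j.+1 b ltjk).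
  split.
  + by move=> b /L1[x [cx ->]]; apply/L2; exists x; auto.
  + exists (i a); split; first by apply/L2; exists a.
    by case/L1 => x [cx /inji ax]; rewrite ax in cNa.
  + move=> N [N0 ND NZ] leN geN.
    have [|||E|E] := simple (fun x => N (i x)).
    * by split; rewrite ?i0 // => *; rewrite ?iD ?iZ; auto.
    * by move=> x cx; apply: leN; apply/L1; exists x.
    * by move=> x /geN/L2[y [cy /inji ->]].
    * left=> b; split=> [Nb|]; last exact: leN.
      by have /L2[x [_ bx]] := geN _ Nb; apply/L1; exists x; split=> //; apply/E; rewrite -bx.
    * right=> b; split=> [|/L2[x [cx ->]]]; first exact: geN.
      by apply/E.
rewrite -(subnKC lekj) ltn_add2l -addnS; move: (j - k)%N => {lekj}j ltj.
have [sub [a [da dNa]] simple] := dK _ ltj; split.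
+ by move=> b /eR db; apply/eR; auto.
+ have [b ab] := surj a; exists b; rewrite ab in da dNa; split; first exact/eR.
  by move/eR.
+ move=> N [N0 ND NZ] leN geN.
  (* [N] contains the kernel of [q], so it is the full preimage of its image, and simplicity of the
     step in [C] applies. *)
  have Nq b : (exists b', N b' /\ q b = q b') <-> N b.
    split=> [[b' [Nb' qb]]|Nb]; last by exists b.
    rewrite -(subrK b' b); apply: ND => //; apply: leN; apply/eR.
    rewrite -scaleN1r addrC qD qZ qb scaleN1r addNr.
    by have [] := dS j.
  have [|||E|E] := simple (fun x => exists b', N b' /\ x = q b').
  * split.
    - by exists 0.
    - by move=> x y [b [Nb ->]] [b' [Nb' ->]]; exists (b + b'); rewrite qD; auto.
    - by move=> t x [b [Nb ->]]; exists (t *: b); rewrite qZ; auto.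
  * move=> x; have [b ->] := surj x => dx; exists b; split=> //.
    by apply: leN; apply/eR.
  * by move=> x [b [/geN/eR db ->]].
  * by left=> b; rewrite -Nq E eR.
  * by right=> b; rewrite -Nq E eR.
Qed.

End FiniteLength.

(** * Pullback of exact sequences *)

Section PullbackModule.
Variables (R : idomainType) (U V W : lmodType R).
Variables (f : {linear U -> W}) (g : {linear V -> W}).

Definition pullback_pred : {pred U * V} := [pred w | f w.1 == g w.2].

Fact pullback_submod : subsemimod_closed pullback_pred.
Proof.
split; [split|].
- by rewrite !inE /= !linear0.
- by move=> x y; rewrite !inE /= => /eqP fx /eqP fy; rewrite !linearD fx fy.
by move=> a x; rewrite !inE /= => /eqP fx; rewrite !linearZ fx.
Qed.

HB.instance Definition _ :=
  GRing.isSubmodClosed.Build R (U * V)%type pullback_pred pullback_submod.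

(** A subtype of the product, so that it inherits the [lmodType] structure required of an ambient
    module. *)
Record pullback := Pullback { pb_val :> U * V; _ : pb_val \in pullback_pred }.

HB.instance Definition _ := [isSub for pb_val].
HB.instance Definition _ := [Choice of pullback by <:].
HB.instance Definition _ := [SubChoice_isSubLmodule of pullback by <:].

End PullbackModule.

Definition linear_of_hom (R : idomainType) (X Y : sobj R) (f : amb X -> amb Y)
    (hf : is_hom X Y f) : {linear amb X -> amb Y} :=
  HB.pack_for {linear amb X -> amb Y} f
    (GRing.isLinear.Build R (amb X) (amb Y) *:%R f (proj1 hf)).

(** The ambient module is the fibre product of [Y] and [E] over [Z], with the submodule taken
    componentwise. It has finite length as an extension of [E] by [X], and [p ^+ n] kills it because
    it kills [Y] and [E]. *)
Lemma pullback_exact (R : idomainType) (p : R) (n : nat) (X Y Z E : sobj R)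
    (u : amb X -> amb Y) (v : amb Y -> amb Z) (g : amb E -> amb Z) :
  exact_seq u v -> is_hom E Z g -> in_Sn p n X -> in_Sn p n Y -> in_Sn p n E ->
  exists (W : sobj R) (i : amb X -> amb W) (q : amb W -> amb E) (t : amb W -> amb Y),
    [/\ in_Sn p n W, exact_seq i q, is_hom W Y t,
        forall x, t (i x) = u x & forall w, v (t w) = g (q w)].
Proof.
move=> exuv hg [[[flX _] sX] _] [[_ sY] nY] [[[flE _] sE] nE].
have [hu hv] := (exact_homl exuv, exact_homr exuv).
pose P := pullback (linear_of_hom hv) (linear_of_hom hg).
pose W := SObj (P : lmodType R) (fun w => sbm Y (\val w).1 /\ sbm E (\val w).2).
have iP x : (u x, 0) \in pullback_pred (linear_of_hom hv) (linear_of_hom hg).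
  by rewrite inE /= (exact_comp0 exuv) (hom0 hg).
pose i x : amb W := Pullback (iP x).
pose q (w : amb W) := (\val w).2; pose t (w : amb W) := (\val w).1.
have vt w : v (t w) = g (q w) by case: w => w wP; apply/eqP.
have li : linear i.
  move=> a x y; apply: val_inj; rewrite linearP /=; congr pair; first exact: hu.1.
  by rewrite /= scaler0 addr0.
have lq : linear q by move=> a x y; rewrite /q linearP.
have lt : linear t by move=> a x y; rewrite /t linearP.
have inji : injective i by move=> x y ixy; apply: (exact_inj exuv); apply: (congr1 t ixy).
have kerq w : q w = 0 <-> exists x, w = i x.
  split=> [qw|[x ->] //]; have := vt w; rewrite qw (hom0 hg).
  case: exuv => _ _ [ker _] _ _ /ker[x tw]; exists x; apply: val_inj.
  by rewrite /= -tw -qw -surjective_pairing.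
have surjq e : exists w, e = q w.
  have [y gy] := exact_surj exuv (g e).
  have yP : (y, e) \in pullback_pred (linear_of_hom hv) (linear_of_hom hg).
    by rewrite inE /= -gy.
  by exists (Pullback yP).
have nW w : p ^+ n *: w = 0 :> amb W.
  apply: val_inj; rewrite linearZ /= [val w]surjective_pairing.
  by congr pair; rewrite ?nY ?nE.
exists W, i, q, t; split=> //.
- split=> //; split; first split.
  + exact: finite_length_ext li lq inji kerq surjq flX flE.
  + by exists n.
  have [[Y0 YD YZ] [E0 ED EZ]] := (sY, sE).
  have AW w : sbm Y (t w) -> sbm E (q w) -> sbm W w by [].
  split=> [|x y [Yx Ex] [Yy Ey]|a x [Yx Ex]]; apply: AW; rewrite /t /q ?linear0 //.
  + by rewrite linearD; apply: YD.
  + by rewrite linearD; apply: ED.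
  + by rewrite linearZ; apply: YZ.
  + by rewrite linearZ; apply: EZ.
- split=> //.
  + split; split=> //; last by move=> w [].
    by move=> x Ax; split; [exact: hu.2 | have [] := sE].
  + by move=> x ix0; apply: inji; rewrite ix0; apply: val_inj; rewrite /= (hom0 hu).
  + move=> w [Yw Ew] /kerq[x wx]; exists x; split=> //.
    have tw : val w = (u x, 0) by rewrite wx.
    case: (exuv) => _ _ _ sub _; rewrite tw /= in Yw.
    by have [x' [Xx' /(exact_inj exuv) ->]] := sub _ Yw (exact_comp0 exuv x).
  (* [g e] lies in the submodule of [Z], hence lifts to the submodule of [Y]; the lift is paired
     with [e]. *)
  + move=> e Ee; case: exuv => _ _ _ _ sub.
    have [y [Yy gy]] := sub _ (hg.2 _ Ee).
    have yP : (y, e) \in pullback_pred (linear_of_hom hv) (linear_of_hom hg).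
      by rewrite inE /= -gy.
    by exists (Pullback yP).
- by split=> // w [].
Qed.

(** * Arithmetic modulo the maximal ideal *)

Section MaximalIdeal.
Variables (R : idomainType) (p : R).
Hypothesis maxp : generates_maximal_ideal p.

(** The ideal generated by [a] and [p] properly contains that of [p], so maximality puts 1 in it. *)
Lemma invertible_mod a : ~ divides p a -> exists b c, b * a = 1 + c * p.
Proof.
move=> pNa; pose J x := exists b c, x = b * a + c * p.
have JI : is_ideal J.
  split.
  - by exists 0, 0; rewrite !mul0r addr0.
  - move=> x y [b [c ->]] [b' [c' ->]]; exists (b + b'), (c + c').
    by rewrite !mulrDl addrACA.
  - by move=> t x [b [c ->]]; exists (t * b), (t * c); rewrite mulrDr !mulrA.
case: maxp => _ /(_ J JI)[x [c ->]|Jp|Jall].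
- by exists 0, c; rewrite mul0r add0r.
- by case: pNa; apply: Jp; exists 1, 0; rewrite mul1r mul0r addr0.
- have [b [c e1]] := Jall 1; exists b, (- c).
  by rewrite e1 mulNr addrK.
Qed.

Lemma exprS_ndivides k j : p != 0 -> (j < k)%N -> ~ divides (p ^+ k) (p ^+ j).
Proof.
move=> p0 ltjk [c]; rewrite -(subnK ltjk) addnS exprS exprD => e; case: maxp => Np1 _.
apply: Np1; exists (c * p ^+ (k - j.+1)).
apply: (mulIf (expf_neq0 j p0)); rewrite mul1r [LHS]e.
by rewrite -!mulrA; congr (c * _); rewrite mulrCA [p * _]mulrC.
Qed.

End MaximalIdeal.

(** * The pairing for two Auslander-Reiten sequences with the same start *)

Section AuslanderReiten.
Variable R : idomainType.

(** For [Z] of finite length with local endomorphism ring: every endomorphism is a scalar modulo the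
    radical. It is phrased by [split_epi] because this is what the right almost split property
    consumes. *)
Definition residues_scalar (Z : sobj R) : Prop :=
  forall f : amb Z -> amb Z, is_hom Z Z f ->
    exists a : R, ~ @split_epi R Z Z (fun z => f z - a *: z).

(** [f] induces endomorphisms [t] of [Y] and [g] of [Z]. When [g - a] is not split epi it factors
    through [v], so [f - a] extends along [u]. *)
Lemma AR_residue (U : sobj R -> Prop) (X Y Z : sobj R)
    (u : amb X -> amb Y) (v : amb Y -> amb Z) :
  (forall W, U W -> submod (sbm W)) -> AR_sequence U u v -> residues_scalar Z ->
  forall f : amb X -> amb X, is_hom X X f ->
    exists a : R, @extends_along R X Y X (fun x => f x - a *: x) u.
Proof.
move=> smU [[UX [UY UZ]] exuv _ [[[x0 x0N0] indX] _] [[_ _ _ _ ras] [_ _ _ uNs las]]] resZ f hf.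
have [hu hv] := (exact_homl exuv, exact_homr exuv).
(* A retraction [r] of [u f] makes [f r u] an idempotent of the indecomposable [X]: if zero it would
   kill [x0], if the identity it would split [u]. *)
have ufNs : ~ split_mono (fun x => u (f x)).
  move=> [r [hr ruf]]; pose e x := f (r (u x)).
  have he : is_hom X X e by apply: is_hom_comp hf; apply: is_hom_comp hu hr.
  have [e0|e1] := indX e he (fun x => congr1 f (ruf _)).
    have f0 : f x0 = 0 by rewrite -[RHS](e0 (f x0)) /e ruf.
    by apply: x0N0; rewrite -[LHS]ruf f0 (hom0 hu) (hom0 hr).
  by apply: uNs; exists (fun y => f (r y)); split=> //; apply: is_hom_comp hr hf.
have [t [ht tu]] := las _ _ UY (is_hom_comp hf hu) ufNs.
have [|g [hg gv]] := @exact_desc _ _ _ _ _ _ exuv _ (fun y => v (t y)) (is_hom_comp ht hv).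
  by move=> x; rewrite -tu (exact_comp0 exuv).
have [a aP] := resZ g hg; exists a.
have hsub W (k : amb W -> amb W) : U W -> is_hom W W k ->
    is_hom W W (fun w => k w - a *: w).
  by move=> /smU sW hk; apply: is_hom_sub => //; apply: is_hom_scale.
apply/(factors_iff_extends (b := fun y => t y - a *: y)
         (c := fun z => g z - a *: z) exuv exuv (smU _ UY)).
- exact: hsub.
- by move=> x; rewrite homB // homZ // tu.
- by move=> y; rewrite homB // homZ // gv.
- by apply: ras => //; apply: hsub.
Qed.

(** The argument is formal: the shape of [Z] enters only through [residues_scalar] and the
    membership of [Y] in S(n). *)
Lemma AR_pairing (p : R) (n : nat) (U : sobj R -> Prop) (X Y Z Y' C : sobj R)
    (u : amb X -> amb Y) (v : amb Y -> amb Z)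
    (u' : amb X -> amb Y') (v' : amb Y' -> amb C) :
  generates_maximal_ideal p -> (forall W, U W -> submod (sbm W)) ->
  AR_sequence U u v -> residues_scalar Z -> in_Sn p n Y ->
  AR_sequence (in_Sn p n) u' v' ->
  one_dim_quotient p C v /\ left_nondegenerate p n C v.
Proof.
move=> maxp smU ARuv resZ SnY [[SnX [SnY' SnC]] ex' v'Ns [[[x0 x0N0] _] _] [ras' las']].
have res := AR_residue smU ARuv resZ.
case: ARuv => [[UX [UY UZ]] exuv vNs _ [_ [_ _ _ uNs las]]].
case: las' ras' => [_ _ _ u'Ns las'] [_ _ _ _ ras'].
have [hu hv] := (exact_homl exuv, exact_homr exuv).
have [[sX sY] sZ] := (smU _ UX, smU _ UY, smU _ UZ).
(* [p] acts nilpotently on the nonzero [X], so multiplication by [p] has no retraction; it therefore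
   extends along both [u] and [u']. *)
have scale_nsplit : ~ @split_mono R X X (fun x => p *: x).
  move=> [r [hr rp]]; apply: x0N0; have [_ nX] := SnX.
  have: forall k x, p ^+ k *: x = 0 -> x = 0 :> amb X.
    elim=> [|k IH] x; first by rewrite scale1r.
    by rewrite exprS -scalerA => /(congr1 r); rewrite rp (hom0 hr) => /IH.
  exact.
have [h' [hh' uE]] := las' _ _ SnY hu uNs.
have [|h [hh hE]] := @exact_desc _ _ _ _ _ _ ex' _ (fun y => v (h' y)) (is_hom_comp hh' hv).
  by move=> x; rewrite -uE (exact_comp0 exuv).
have nondeg : left_nondegenerate p n C v.
  move=> E g SnE hg gNv.
  have [W [i [q [t [SnW exiq ht ti vt]]]]] := pullback_exact exuv hg SnX SnY SnE.
  have [hi hq] := (exact_homl exiq, exact_homr exiq).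
  have sW : submod (sbm W) by case: SnW => -[].
  have iNs : ~ split_mono i.
    move=> /(split_mono_epi exiq sW)[s [hs qs]]; apply: gNv.
    by exists (fun e => t (s e)); split; [apply: is_hom_comp hs ht | move=> e; rewrite vt qs].
  have [k [hk ik]] := las' _ _ SnW hi iNs.
  have [|f [hf fE]] := @exact_desc _ _ _ _ _ _ ex' _ (fun y => q (k y)) (is_hom_comp hk hq).
    by move=> x; rewrite -ik (exact_comp0 exiq).
  exists f; split=> // gfv; apply: u'Ns.
  (* If [g f] factored through [v], the identity of [X] would extend along [u'], splitting it. *)
  have [] // := factors_iff_extends (a := id) (b := fun y => t (k y))
    (c := fun x => g (f x)) ex' exuv sY (is_hom_comp hk ht).
  - by move=> x; rewrite -ti ik.
  - by move=> y; rewrite vt fE.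
  by move=> /(_ gfv)[r [hr ur]] _; exists r; split=> // x; rewrite -ur.
split=> //.
have hNv : ~ factors_through h v.
  move=> hv0; apply: u'Ns.
  have [] // := factors_iff_extends (a := id) (b := h') (c := h) ex' exuv sY hh'.
  by move=> /(_ hv0)[r [hr ur]] _; exists r; split=> // x; rewrite -ur.
exists h; split=> //.
  apply/(factors_iff_extends (a := fun x => p *: x) (b := fun y => p *: h' y)
           (c := fun x => p *: h x) ex' exuv sY).
  - exact: is_hom_scale.
  - by move=> x; rewrite homZ // uE.
  - by move=> y; rewrite homZ // hE.
  - by apply: las' => //; apply: is_hom_scale.
move=> g hg; have [[k [hk gk]]|gNv] := classic (factors_through g v).
  by exists 0, k; split=> // x; rewrite scale0r subr0.
have [W [i [q [t [SnW exiq ht ti vt]]]]] := pullback_exact exuv hg SnX SnY SnC.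
have [hi hq] := (exact_homl exiq, exact_homr exiq).
have qNs : ~ split_epi q.
  move=> [s [hs qs]]; apply: gNv.
  by exists (fun e => t (s e)); split; [apply: is_hom_comp hs ht | move=> e; rewrite vt qs].
have [k [hk qk]] := ras' _ _ SnW hq qNs.
have [|f [hf kf]] := @exact_lift _ _ _ _ _ _ ex' X (fun x => k (i x)) (is_hom_comp hi hk).
  by move=> x; rewrite -qk (exact_comp0 exiq).
have ext_i (a : amb X -> amb X) : extends_along a u -> extends_along a i.
  by move=> [w [hw aw]]; exists (fun x => w (t x)); split=> [|x];
    [apply: is_hom_comp ht hw | rewrite ti].
have [a fa] := res f hf.
(* The triple ([f - a], [h' k - a t], [h - a g]) maps the pulled-back sequence to xi, and [f - a]
   extends along [u], hence along [i], because [t i = u]. *)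
have hag : factors_through (fun x => h x - a *: g x) v.
  apply/(factors_iff_extends (a := fun x => f x - a *: x)
           (b := fun w => h' (k w) - a *: t w) exiq exuv sY); last exact: ext_i.
  - by apply: is_hom_sub => //; [apply: is_hom_comp hk hh' | apply: is_hom_scale].
  - by move=> x; rewrite homB // homZ // uE -kf ti.
  - by move=> w; rewrite homB // homZ // hE -qk vt.
have pg : factors_through (fun x => p *: g x) v.
  apply/(factors_iff_extends (a := fun x => p *: x) (b := fun w => p *: t w)
           exiq exuv sY).
  - exact: is_hom_scale.
  - by move=> x; rewrite homZ // ti.
  - by move=> w; rewrite homZ // vt.
  - by apply: ext_i; apply: las => //; apply: is_hom_scale.
case: hag pg => [s [hs hagE]] [s' [hs' pgE]].
(* Otherwise [a g] would factor through [v] along with [p g], and then so would [h]. *)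
have pNa : ~ divides p a.
  move=> [c ac]; apply: hNv; exists (fun x => s x - (- c) *: s' x); split.
    by apply: is_hom_sub => //; apply: is_hom_scale.
  by move=> x; rewrite homB // homZ // -hagE -pgE scalerA mulNr -ac scaleNr opprK subrK.
have [b [c ba]] := invertible_mod maxp pNa.
(* From [b a = 1 + c p] one gets [g - b h = - b (h - a g) - c p g], where both terms factor. *)
exists b; exists (fun x => (- b) *: s x - c *: s' x); split.
  by apply: is_hom_sub; rewrite //; apply: is_hom_scale.
move=> x; rewrite (homB hv) !(homZ hv) -hagE -pgE scalerBr !scalerA mulNr ba.
by rewrite !scaleNr opprK scalerDl scale1r addrA addrK addrC.
Qed.
End AuslanderReiten.

(** * Explicit computations in pickets and bipickets *)

Section PicketsAndBipickets.
Variables (R : idomainType) (p : R).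
Hypotheses (maxp : generates_maximal_ideal p) (p0 : p != 0).

Lemma iter_lift (B : lmodType R) (A : B -> Prop) s b :
  iter s (@Defs.lift R p B) A b <-> A (p ^+ s *: b).
Proof.
elim: s b => [|s IH] b; first by rewrite expr0 scale1r.
by rewrite iterS {1}/Defs.lift IH exprSr scalerA.
Qed.

Lemma cyclic_pres_exp m (B : lmodType R) (e : B) :
  cyclic_pres p m e -> forall b : B, p ^+ m *: b = 0.
Proof.
move=> [ann gen] b; have [a ->] := gen b.
have e0 : p ^+ m *: e = 0 by apply/ann; exists 1; rewrite mul1r.
by rewrite scalerA mulrC -scalerA e0 scaler0.
Qed.

Lemma bicyclic_pres_inj m r (B : lmodType R) (e1 e2 : B) a1 a2 b1 b2 :
  bicyclic_pres p m r e1 e2 -> a1 *: e1 + a2 *: e2 = b1 *: e1 + b2 *: e2 ->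
  divides (p ^+ m) (a1 - b1) /\ divides (p ^+ r) (a2 - b2).
Proof.
move=> [ann _] eqab; apply/ann; rewrite !scalerBl addrACA -opprD eqab.
by rewrite subrr.
Qed.

Lemma bicyclic_pres_exp m r (B : lmodType R) (e1 e2 : B) :
  (r <= m)%N -> bicyclic_pres p m r e1 e2 -> forall b : B, p ^+ m *: b = 0.
Proof.
move=> lerm [ann gen] b; have [a1 [a2 ->]] := gen b.
rewrite scalerDr !scalerA; apply/ann; split.
  by exists a1; rewrite mulrC.
by exists (a2 * p ^+ (m - r)); rewrite -mulrA -exprD subnK // mulrC.
Qed.

Lemma T2_exp m r (T : sobj R) :
  (r < m)%N -> is_T2 p m r T -> forall b : amb T, p ^+ m *: b = 0.
Proof.
rewrite /is_T2 => ltrm; case: ifP => _ [e].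
  by case=> /cyclic_pres_exp.
by case=> e2 [/bicyclic_pres_exp exp _]; apply: exp; apply: ltnW.
Qed.

(** Says that the lifted submodule is not killed by [p ^+ (l - 2)], the input of [in_Sn_middle]. *)
Lemma T2_nonzero m r l (T : sobj R) :
  (2 <= l)%N -> (l <= r.+1)%N -> (r < m)%N -> is_T2 p m r T ->
  exists b : amb T, sbm T (p ^+ (l - 2) *: b) /\ p ^+ (l - 2) *: b <> 0.
Proof.
move=> l2 ler ltrm; have lem := leq_trans ler ltrm; rewrite /is_T2; case: ifP => _.
  move=> [e [[ann gen] sT]]; exists (p ^+ (m - l) *: e).
  rewrite scalerA -exprD; have -> : (l - 2 + (m - l) = m - 2)%N by lia.
  split; first by apply/sT; exists 1; rewrite scale1r.
  by move/ann; apply: exprS_ndivides => //; lia.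
(* Multiplied by [p ^+ (l - 2)] this gives [p ^+ (m - 1) *: e1], which is [p] times the generator of
   the submodule since [p ^+ r *: e2 = 0]. *)
move=> [e1 [e2 [[ann gen] sT]]]; exists (p ^+ (m - l).+1 *: e1).
rewrite scalerA -exprD; have -> : (l - 2 + (m - l).+1 = (m - 2).+1)%N by lia.
split.
  apply/sT; exists p; rewrite scalerDr !scalerA -!exprS.
  have -> : (r - 1).+1 = r by lia.
  have: 0 *: e1 + p ^+ r *: e2 = 0.
    by apply/ann; split; [exists 0; rewrite mul0r | exists 1; rewrite mul1r].
  by rewrite scale0r add0r => ->; rewrite addr0.
move=> e0; have [|+ _] := (ann (p ^+ (m - 2).+1) 0).1.
  by rewrite e0 scale0r addr0.
by apply: exprS_ndivides => //; lia.
Qed.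

(** On a picket [f] is a scalar. On a bipicket let [a] be the [e1]-coefficient of [f e1]: every
    value of [f - a] has as [e1]-coefficient a multiple of the [e1]-coefficient [c] of [f e2]. As
    [p] divides [c], the vector [e1] is not a value. *)
Lemma T2_residues m r l (T : sobj R) :
  (2 <= l)%N -> (l <= r.+1)%N -> (r < m)%N -> is_T2 p m r T ->
  residues_scalar (lift_obj p (l - 2) T).
Proof.
move=> l2 ler ltrm; have lem := leq_trans ler ltrm; rewrite /is_T2; case: ifP => rm.
  move=> [e [[ann gen] sT]] f hf; have [a fe] := gen (f e); exists a.
  move=> [s [hs fs]]; have := fs e; have [b ->] := gen (s e).
  rewrite (homZ hf) fe !scalerA mulrC subrr => /esym e0.
  apply: (exprS_ndivides maxp p0 (_ : 0 < m)%N); first by lia.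
  by rewrite expr0; apply/ann; rewrite scale1r.
move=> [e1 [e2 [pres sT]]] f hf; have [ann gen] := pres.
have [a [b fe1]] := gen (f e1); have [c [d fe2]] := gen (f e2); exists a.
(* [P e1 + Q e2] generates the submodule of [T]. The exponent of [K] is not truncated, since [r.+1]
   differs from [m] here. *)
pose P := p ^+ (m - 2); pose Q := p ^+ (r - 1); pose K := p ^+ (m - 2 - r).
have Pm : p ^+ m = P * p * p by rewrite -!exprSr; congr (_ ^+ _); lia.
have Qr : p ^+ r = Q * p by rewrite -exprSr; congr (_ ^+ _); lia.
have PQ : P = Q * p * K by rewrite -exprSr -exprD; congr (_ ^+ _); lia.
have [PN0 QN0] : P != 0 /\ Q != 0 by rewrite !expf_neq0.
(* Applying [f] to [p ^+ r *: e2 = 0] shows that [p ^+ m] divides [p ^+ r * c]. *)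
have [c' cE] : exists c', Q * c = c' * P * p.
  have [] := @bicyclic_pres_inj m r _ e1 e2 (p ^+ r * c) (p ^+ r * d) 0 0 pres.
    rewrite -!scalerA -scalerDr -fe2 -(homZ hf) !scale0r addr0.
    have: 0 *: e1 + p ^+ r *: e2 = 0.
      by apply/ann; split; [exists 0; rewrite mul0r | exists 1; rewrite mul1r].
    by rewrite scale0r add0r => ->; apply: hom0 hf.
  rewrite subr0 => -[c' cE] _; exists c'; apply: (mulfI p0).
  by transitivity (p ^+ r * c); [rewrite Qr | rewrite cE Pm]; ring.
(* [w] lies in the lifted submodule and [p ^+ (l - 2) *: w] is the generator, so [f] multiplies the
   generator by some [x]. Comparing coefficients makes [a] and [d] congruent to [x] modulo [p]. *)
have [x []] : exists x, divides (p ^+ m) (P * a + Q * c - x * P) /\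
                     divides (p ^+ r) (P * b + Q * d - x * Q).
  pose w := p ^+ (m - l) *: e1 + p ^+ (r.+1 - l) *: e2.
  have wE : p ^+ (l - 2) *: w = P *: e1 + Q *: e2.
    rewrite scalerDr !scalerA -!exprD; congr (_ ^+ _ *: _ + _ ^+ _ *: _); lia.
  have /hf.2/iter_lift : iter (l - 2) (@Defs.lift R p (amb T)) (sbm T) w.
    by apply/iter_lift/sT; exists 1; rewrite scale1r wE.
  rewrite -(homZ hf) wE (homD hf) !(homZ hf) fe1 fe2 => /sT[x xE]; exists x.
  apply: (bicyclic_pres_inj pres); move: xE.
  by rewrite !scalerDr !scalerA addrACA -!scalerDl.
move=> [y yE] [y' y'E].
have aE : a - x = (y * p - c') * p.
  apply: (mulfI PN0); transitivity (P * a + Q * c - x * P - Q * c); first by ring.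
  by rewrite yE cE Pm; ring.
have dE : d - x = (y' - K * b) * p.
  apply: (mulfI QN0); transitivity (P * b + Q * d - x * Q - P * b); first by ring.
  by rewrite y'E Qr PQ; ring.
have cE' : c = c' * K * p * p.
  apply: (mulfI QN0); rewrite cE PQ; ring.
move=> [s [hs fs]]; have [al [be sE]] := gen (s e1).
have := fs e1; rewrite sE (homD hf) !(homZ hf) fe1 fe2.
have -> : al *: (a *: e1 + b *: e2) + be *: (c *: e1 + d *: e2) -
          a *: (al *: e1 + be *: e2) =
          (be * c) *: e1 + (al * b + be * (d - a)) *: e2.
  rewrite !scalerDr !scalerA addrACA -!scalerDl opprD addrACA -!scalerBl.
  by congr (_ *: _ + _ *: _); ring.
(* The [e1]-coefficient gives [be * c] congruent to 1 modulo [p ^+ m], although [p] divides [c]. *)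
move=> eq1; have [] := @bicyclic_pres_inj _ _ _ _ _ (be * c) (al * b + be * (d - a)) 1 0 pres.
  by rewrite eq1 scale1r scale0r addr0.
move=> [z zE] _; case: maxp => p1 _; apply: p1.
exists (be * c' * K * p - z * P * p).
transitivity (be * c - (be * c - 1)); first by ring.
by rewrite zE cE' Pm; ring.
Qed.

(** For E in S(n), a morphism from [C] to E is a free choice of the image of [g] in the submodule of
    E. A morphism to [Z] factors through the inclusion exactly when it sends the submodule into the
    multiples of [p], so [C] detects the failure. *)
Lemma picket_full_pairing n l (C Z : sobj R) :
  (0 < l)%N -> (l <= n)%N -> is_picket p n n C ->
  (exists e : amb Z, cyclic_pres p l e) -> (forall b, sbm Z b) ->
  let W := SObj (amb Z) (fun b => exists c : amb Z, b = p *: c) in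
  one_dim_quotient p C (fun z : amb W => (z : amb Z)) /\
  left_nondegenerate p n C (fun z : amb W => (z : amb Z)).
Proof.
move=> l0 len [g [[annC genC] sC]] [e presZ] sZ W; have [annZ genZ] := presZ.
have sCg : sbm C g.
  by apply/sC; exists 1; rewrite subnn expr0 !scale1r.
have exC x : exists a, x == a *: g by have [a ->] := genC x; exists a.
have to (E : sobj R) (y : amb E) : submod (sbm E) -> sbm E y -> p ^+ n *: y = 0 ->
    exists f : amb C -> amb E, is_hom C E f /\ f g = y.
  move=> [_ _ mulE] Ey ny; pose k x := xchoose (exC x).
  have kE x : x = k x *: g by apply/eqP; apply: (xchooseP (exC x)).
  have wd a x : x = a *: g -> k x *: y = a *: y.
    move=> xa; apply/eqP; rewrite -subr_eq0 -scalerBl; apply/eqP.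
    have /annC[c ->] : (k x - a) *: g = 0 by rewrite scalerBl -kE -xa subrr.
    by rewrite -scalerA ny scaler0.
  exists (fun x => k x *: y); split; last by rewrite (wd 1) ?scale1r.
  split=> [a x x'|x _]; last exact: mulE.
  by rewrite (wd (a * k x + k x')) ?scalerDl ?scalerA // -scalerA -!kE.
have nZ (b : amb Z) : p ^+ n *: b = 0.
  by rewrite -(subnK len) exprD -scalerA (cyclic_pres_exp presZ) scaler0.
have smZ : submod (sbm Z) by split.
have smW : submod (sbm W).
  split=> [|x y [c ->] [d ->]|a x [c ->]].
  - by exists 0; rewrite scaler0.
  - by exists (c + d); rewrite scalerDr.
  - by exists (a *: c); rewrite !scalerA mulrC.
split; last first.
  move=> E f [[_ sE] nE] hf fN.
  (* The inclusion is the identity on ambient modules, so [f] itself is the only candidate for a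
     factorization. *)
  have [x [Ex Nx]] : exists x, sbm E x /\ ~ exists c, f x = p *: c.
    apply: NNPP => H; apply: fN; exists f; split=> //; split; first exact: hf.1.
    by move=> x Ex; apply: NNPP => H'; apply: H; exists x.
  have [k [hk kg]] := to E x sE Ex (nE x).
  exists k; split=> // -[k' [hk' kk']]; apply: Nx.
  by have := hk'.2 g sCg; rewrite -kk' kg.
have [h [hh hg]] := to Z e smZ (sZ e) (nZ e).
exists h; split=> //.
- move=> [k [hk kk]]; have := hk.2 g sCg; rewrite -kk hg => -[c ce].
  have [b cb] := genZ c; case: maxp => p1 _; apply: p1.
  (* From [e = (p * b) *: e] it follows that [p ^+ l] divides [1 - p * b]; as [l] is positive, [p]
     would be a unit. *)
  have [z zE] : divides (p ^+ l) (1 - p * b).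
    by apply/annZ; rewrite scalerBl scale1r {1}ce cb scalerA subrr.
  exists (z * p ^+ l.-1 + b); rewrite mulrDl -mulrA -exprSr prednK // -zE.
  by rewrite mulrC subrK.
- exists (fun x => p *: h x); split=> //; split=> [a x y|x _]; last by exists (h x).
  by have := (is_hom_scale p smZ hh).1 a x y.
- move=> f hf; have [a fa] := genZ (f g); exists a, (fun=> 0); split.
    exact: is_hom_zero.
  move=> x; have [b ->] := genC x.
  by rewrite (homZ hf) (homZ hh) fa hg !scalerA mulrC subrr.
Qed.

End PicketsAndBipickets.

(* The identity is a morphism from the s-fold lift of (0 in B) to Z = (A in B)
   that is not split epi, so it equals v h; hence Y = u X + h B. *)
Lemma in_Sn_middle (R : idomainType) (p : R) (n s : nat) (X Y Z : sobj R)
    (u : amb X -> amb Y) (v : amb Y -> amb Z) :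
  AR_sequence (in_S2lift p s) u v -> in_Sn p n X ->
  (forall z : amb Z, p ^+ n *: z = 0) ->
  (exists z : amb Z, sbm Z z /\ p ^+ s *: z <> 0) -> in_Sn p n Y.
Proof.
move=> [[_ [[SY _] [[mZ _] [A [[A0 _ _] _ ZA]]]]] exuv _ _ [[_ _ _ _ ras] _]] [_ nX] nZ [z [Zz zN0]].
split=> // y.
pose Z0 := SObj (amb Z) (iter s (@Defs.lift R p (amb Z)) (fun b => b = 0)).
have sZ0 b : sbm Z0 b <-> p ^+ s *: b = 0 by apply: iter_lift.
have Z0Z : is_hom Z0 Z id.
  by split=> // b /sZ0 b0; apply/ZA/iter_lift; rewrite b0.
have Z0Ns : ~ @split_epi R Z0 Z id.
  by move=> [k [[_ hk] kid]]; apply: zN0; apply/sZ0; rewrite -[z]kid; apply: hk.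
have UZ0 : in_S2lift p s Z0.
  split; first (split=> //; split=> [|b c /sZ0 b0 /sZ0 c0|a b /sZ0 b0]; apply/sZ0).
  - by rewrite scaler0.
  - by rewrite scalerDr b0 c0 addr0.
  - by rewrite scalerA mulrC -scalerA b0 scaler0.
  exists (fun b => b = 0); split=> // [|a ->]; last by rewrite scaler0.
  by split=> // [b c -> ->|a b ->]; rewrite ?addr0 ?scaler0.
have [h [hh hE]] := ras Z0 id UZ0 Z0Z Z0Ns.
have [hu hv] := (exact_homl exuv, exact_homr exuv).
have: v (y - h (v y)) = 0 by rewrite (homB hv) -hE subrr.
case: (exuv) => _ _ [ker _] _ _ /ker[x yx].
rewrite -(subrK (h (v y)) y) yx scalerDr -(homZ hu) -(homZ hh) nX nZ.
by rewrite (hom0 hu) (hom0 hh) addr0.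
Qed.

(** * The projective case and the case of an Auslander-Reiten sequence *)

Theorem theorem5 (R : idomainType) (p : R)
  (hPID : is_PID R) (hmax : generates_maximal_ideal p) (hp0 : p != 0)
  (l r m n : nat) (hl : (2 <= l)%N) (hlr : (l <= r.+1)%N) (hrm : (r.+1 <= m)%N)
  (hmn : (m <= n)%N)
  (T : sobj R) (hT : is_T2 p m r T) :
  let Z := lift_obj p (l - 2) T in
  (* projective case: Z = P_l^l, v the inclusion P_{l-1}^l -> P_l^l, C = P_n^n *)
  ((r.+1 == m) && (m == l) ->
     let W := SObj (amb Z) (fun b => exists c : amb Z, b = p *: c) in
     forall C : sobj R, is_picket p n n C ->
       one_dim_quotient p C (fun z : amb W => (z : amb Z)) /\
       left_nondegenerate p n C (fun z : amb W => (z : amb Z)))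
  /\
  (* otherwise: AR sequence 0 -> X -> Y -> Z -> 0 in S_2↑^{l-2},
     and C = τ^{-1}_{S(n)} X, the end term of the AR sequence in S(n) starting at X *)
  (~~ ((r.+1 == m) && (m == l)) ->
     forall (X Y : sobj R) (u : amb X -> amb Y) (v : amb Y -> amb Z),
       AR_sequence (in_S2lift p (l - 2)) u v ->
     forall (Y' C : sobj R) (u' : amb X -> amb Y') (v' : amb Y' -> amb C),
       AR_sequence (in_Sn p n) u' v' ->
       one_dim_quotient p C v /\ left_nondegenerate p n C v).

Proof.
have [Tm T0] := (T2_exp hrm hT, T2_nonzero hmax hp0 hl hlr hrm hT).
move=> Z; split=> [/andP[/eqP rm /eqP ml] W C hC | _ X Y u v ARuv Y' C u' v' ARuv'].
  move: hT; rewrite /is_T2 rm eqxx => -[e [presT sT]].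
  have presZ : @cyclic_pres R p l (amb Z) e by rewrite -ml.
  apply: (picket_full_pairing hmax _ _ hC); [| |by exists e; exact: presZ|].
  - exact: ltnW.
  - by rewrite -ml.
  (* Since [m = l], each [p ^+ (l - 2) *: b] is a multiple of the generator of [T], so the lifted
     submodule is everything. *)
  move=> b; apply/iter_lift/sT; have [_ /(_ b)[a ->]] := presT.
  by exists a; rewrite ml !scalerA mulrC.
have SnX : in_Sn p n X by case: ARuv' => -[].
have nZ (z : amb Z) : p ^+ n *: z = 0.
  by rewrite -(subnK hmn) exprD -scalerA Tm scaler0.
apply: (AR_pairing hmax _ ARuv _ _ ARuv').
- by move=> V [[_ sV] _].
- exact: (T2_residues hmax hp0 hl hlr hrm hT).
- apply: (in_Sn_middle ARuv SnX nZ); have [z [Tz z0]] := T0.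
  by exists z; split=> //; apply/iter_lift.
Qed.
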